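(* There exists an instance of fair division with market values $\langle \mathcal{N}, \mathcal{M}, v, (u_i)_{i\in\mathcal{N}}\rangle$ with $|\mathcal{N}|=2$ agents and $|\mathcal{M}|=7$ goods (with additive subjective utilities and additive market valuation) in which no allocation is SD-EF1 both with respect to the subjective utilities and with respect to the market valuation.
   Context: An instance of fair division with market values $\langle \mathcal{N}, \mathcal{M}, v, (u_i)_{i\in\mathcal{N}}\rangle$ consists of a finite set $\mathcal{N}$ of $n$ agents, a finite set $\mathcal{M}$ of $m$ indivisible goods, a market valuation $v:2^{\mathcal{M}}\to\mathbb{R}_{\ge 0}$, and a subjective utility function $u_i:2^{\mathcal{M}}\to\mathbb{R}_{\ge 0}$ for each agent $i$. Here all these set functions are additive: $f(S)=\sum_{g\in S} f(\{g\})$ for all $S\subseteq\mathcal{M}$, with $f(\emptyset)=0$; write $f(g)=f(\{g\})$. An allocation $A=(A_1,\dots,A_n)$ is a partition of $\mathcal{M}$ into $n$ pairwise disjoint (possibly empty) bundles, with $A_i$ given to agent $i$ and $\bigcup_i A_i=\mathcal{M}$. SD-preference: for an additive $f$ and $X,Y\subseteq\mathcal{M}$, write $X \succcurlyeq^{\mathsf{SD}}_{f} Y$ if for each good $g\in\mathcal{M}$, $|\{g'\in X: f(g')\ge f(g)\}|\ge |\{g'\in Y: f(g')\ge f(g)\}|$. $A$ is SD-EF1 with respect to the subjective utilities if for every $i,j\in\mathcal{N}$, either $A_j=\emptyset$ or $A_i\succcurlyeq^{\mathsf{SD}}_{u_i} A_j\setminus\{g\}$ for some $g\in A_j$. $A$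 is SD-EF1 with respect to the market valuation if the same holds with every $u_i$ replaced by $v$. *)

(* Defs.v *)
From mathcomp Require Import all_boot all_order all_algebra.
From mathcomp Require Import reals.
Set Implicit Arguments. Unset Strict Implicit. Unset Printing Implicit Defensive.
Import Order.TTheory GRing.Theory Num.Theory.
Local Open Scope ring_scope.

(* The condition at [S = set0] reads [f set0 = 0]. *)
Definition additive_valuation (R : realType) (M : finType)
    (f : {set M} -> R) : Prop :=
  forall S : {set M}, f S = \sum_(g in S) f [set g].

Record market_instance (R : realType) (N M : finType) := MarketInstance {
  market : {set M} -> R;
  utility : N -> {set M} -> R;
  market_ge0 : forall S : {set M}, 0 <= market S;
  utility_ge0 : forall (i : N) (S : {set M}), 0 <= utility i S;
  market_additive : additive_valuation market;
  utility_additive : forall i : N, additive_valuation (utility i)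
}.

(* Bundles may be empty, so this is not [finset.partition]. *)
Definition allocation (N M : finType) (A : N -> {set M}) : Prop :=
  (forall i j : N, i != j -> [disjoint A i & A j])
  /\ \bigcup_(i : N) A i = [set: M].

Definition SD_pref (R : realType) (M : finType) (f : {set M} -> R)
    (X Y : {set M}) : Prop :=
  forall g : M,
    (#|[set g' in Y | (f [set g] <= f [set g'])%R]|
       <= #|[set g' in X | (f [set g] <= f [set g'])%R]|)%N.

Definition SD_EF1 (R : realType) (N M : finType) (f : N -> {set M} -> R)
    (A : N -> {set M}) : Prop :=
  forall i j : N,
    A j = set0 \/ exists2 g : M, g \in A j & SD_pref (f i) (A i) (A j :\ g).

Definition SD_EF1_subjective (R : realType) (N M : finType)
    (I : market_instance R N M) (A : N -> {set M}) : Prop :=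
  SD_EF1 (utility I) A.

Definition SD_EF1_market (R : realType) (N M : finType)
    (I : market_instance R N M) (A : N -> {set M}) : Prop :=
  SD_EF1 (fun _ : N => market I) A.

(* Main.v *)
(** Consider two agents and goods 0, ..., 6, all rankings being strict. A market
    SD-EF1 allocation must split each of the pairs {0,1}, {2,3}, {4,5}. Let the
    agents rank the goods by 2 > 4 > 0 > 5 > 3 > 6 > 1 and
    0 > 4 > 2 > 5 > 1 > 6 > 3. Looking at the 2, 4 and 6 best goods, the first
    agent must get one of 2, 4, one of 0, 2 and one of 0, 6; the second agent must
    get one of 0, 4, one of 0, 2 and one of 2, 6. If the first agent gets 0, then
    the second gets 4 and 2, which is impossible; otherwise the first agent gets
    2 and 6, which is impossible too. *)

Require Import Defs.
From mathcomp Require Import all_boot all_order all_algebra.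
From mathcomp Require Import reals.
Set Implicit Arguments. Unset Strict Implicit. Unset Printing Implicit Defensive.
Import Order.TTheory GRing.Theory Num.Theory.

(** Deleting one good from [A j] lowers each of its upper-level counts by at most one. *)
Lemma SD_EF1_card (R : realType) (N M : finType) (f : N -> {set M} -> R)
    (A : N -> {set M}) (i j : N) (g : M) :
  SD_EF1 f A ->
  #|[set h in A j | (f i [set g] <= f i [set h])%R]| <=
  #|[set h in A i | (f i [set g] <= f i [set h])%R]|.+1.
Proof.
move=> /(_ i j) [Aj0|[x _ /(_ g) le_g]].
  by rewrite Aj0 (_ : [set _ in _ | _] = set0) ?cards0 //; apply/setP=> h; rewrite !inE.
rewrite (cardsD1 x) -add1n leq_add ?leq_b1 //.
apply: leq_trans le_g; apply/eq_leq/eq_card => h.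
by rewrite !inE andbA.
Qed.

(** Additive Borda scores: along a duplicate-free [s] they fall from [size s] to 1; goods outside
    [s] score 0. *)
Definition ranking_value (R : realType) (M : finType) (s : seq M) (S : {set M}) : R :=
  (\sum_(g in S) (size s - index g s)%:R)%R.

Section RankingValue.
Variables (R : realType) (M : finType).
Implicit Types (s : seq M) (S : {set M}) (g : M).

Lemma ranking_value1 s g :
  ranking_value R s [set g] = (size s - index g s)%:R%R.
Proof. by rewrite /ranking_value big_set1. Qed.

Lemma ranking_value_ge0 s S : (0 <= ranking_value R s S)%R.
Proof. by apply: sumr_ge0 => g _; exact: ler0n. Qed.

Lemma ranking_value_additive s : additive_valuation (ranking_value R s).
Proof. by move=> S; apply: eq_bigr => g _; rewrite ranking_value1. Qed.

Lemma ranking_value_top s g h : g \in s ->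
  (ranking_value R s [set g] <= ranking_value R s [set h])%R =
  (h \in take (index g s).+1 s).
Proof.
move=> gs; have lt_g : index g s < size s by rewrite index_mem.
rewrite !ranking_value1 ler_nat in_take_leq // ltnS.
by rewrite leq_sub2lE ?index_size.
Qed.

(** Upper-level sets of Borda scores are prefixes of the ranking, so SD-EF1 yields inequalities that
    compute on concrete lists. *)
Lemma SD_EF1_prefix (N : finType) (s : N -> seq M) (A : N -> {set M}) :
  SD_EF1 (fun i => ranking_value R (s i)) A ->
  forall (i j : N) k, uniq (s i) -> k < size (s i) ->
  count [in A j] (take k.+1 (s i)) <= (count [in A i] (take k.+1 (s i))).+1.
Proof.
move=> ef1 i j k us ltk.
have [x0 _] : exists x0 : M, true by case: (s i) ltk => // x; exists x.
have g_s := mem_nth x0 ltk.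
have card_top S : #|[set h in S | (ranking_value R (s i) [set nth x0 (s i) k]
      <= ranking_value R (s i) [set h])%R]| = count [in S] (take k.+1 (s i)).
  rewrite -size_filter -(card_uniqP _) ?filter_uniq ?take_uniq //.
  apply: eq_card => h.
  by rewrite !inE mem_filter ranking_value_top // index_uniq.
by have := SD_EF1_card i j (nth x0 (s i) k) ef1; rewrite !card_top.
Qed.

End RankingValue.

Lemma allocation_bool (M : finType) (A : bool -> {set M}) :
  allocation A -> A false = ~: A true.
Proof.
case=> dis cov; apply/setP=> g; rewrite !inE.
have := in_setT g; rewrite -cov => /bigcupP[i _ gi].
have /pred0P/(_ g)/= := dis true false isT.
by case: i gi => ->; case: (g \in _).
Qed.

Definition market_ranking : seq 'I_7 := [:: 0; 1; 2; 3; 4; 5; 6]%R.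

Definition agent_ranking (i : bool) : seq 'I_7 :=
  if i then [:: 2; 4; 0; 5; 3; 6; 1]%R else [:: 0; 4; 2; 5; 1; 6; 3]%R.

Theorem theorem1 (R : realType) :
  exists (N M : finType) (I : market_instance R N M),
    [/\ #|N| = 2, #|M| = 7 &
      ~ exists A : N -> {set M},
          [/\ allocation A, SD_EF1_subjective I A & SD_EF1_market I A]].
Proof.
exists bool, 'I_7.
exists (@MarketInstance R bool 'I_7 (ranking_value R market_ranking)
  (fun i => ranking_value R (agent_ranking i))
  (ranking_value_ge0 R market_ranking)
  (fun i => ranking_value_ge0 R (agent_ranking i))
  (ranking_value_additive R market_ranking)
  (fun i => ranking_value_additive R (agent_ranking i))).
split; [exact: card_bool | exact: card_ord |].
case=> A [/allocation_bool AF].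
move=> /SD_EF1_prefix agents /(SD_EF1_prefix (s := fun=> market_ranking)) market.
(* Indices 1, 3, 5 select the prefixes of length 2, 4, 6. Even length turns a deficit of at most one
   into a share of at least half. *)
move: (agents true false 1 isT isT) (agents true false 3 isT isT)
  (agents true false 5 isT isT) (agents false true 1 isT isT)
  (agents false true 3 isT isT) (agents false true 5 isT isT)
  (market true false 1 isT isT) (market true false 3 isT isT)
  (market true false 5 isT isT) (market false true 1 isT isT)
  (market false true 3 isT isT) (market false true 5 isT isT).
rewrite /= AF !inE.
(* As [A false] is the complement of [A true], seven booleans determine the allocation; each of the
   128 cases violates an inequality. *)
case: (0%R \in A true); case: (1%R \in A true); case: (2%:R%R \in A true);
  case: (3%:R%R \in A true); case: (4%:R%R \in A true);
  case: (5%:R%R \in A true); by case: (6%:R%R \in A true).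
Qed.
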